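(* Let $X$ and $Y$ be topological vector spaces (over $\mathbb{R}$), let $\theta$ be the origin of $Y$, let $D$ be a nonempty convex compact subset of $X$, and let $K$ be a nonempty set. Let $F: D\times K \rightrightarrows Y$ and $G: D\times D\rightrightarrows Y$ be set-valued mappings satisfying: (i) for each $y\in K$, the set $\{x\in D: \theta\in F(x,y)\}$ is closed in $D$; (ii) $G$ is a KKM-type mapping on $D$; (iii) for each $y\in K$ there exists $z\in D$ such that for all $x\in D$, $\theta\in G(z,x)$ implies $\theta\in F(x,y)$. Then there exists $\bar x\in D$ such that $\theta\in F(\bar x,y)$ for all $y\in K$.
   Context: A set-valued mapping $G: D\times D\rightrightarrows Y$ is called a KKM-type mapping on $D$ if for every finite subset $\{x_1,\dots,x_n\}\subset D$ and every $x\in \operatorname{co}\{x_1,\dots,x_n\}\cap D$ there exists $j\in\{1,\dots,n\}$ such that $\theta\in G(x_j,x)$. Here $\operatorname{co}$ denotes the convex hull. *)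

(* Defs.v *)
From HB Require Import structures.
From mathcomp Require Import all_boot all_order all_algebra.
From mathcomp Require Import all_classical all_reals all_analysis.
Set Implicit Arguments. Unset Strict Implicit. Unset Printing Implicit Defensive.
Import Order.TTheory GRing.Theory Num.Theory.
Local Open Scope classical_set_scope.
Local Open Scope ring_scope.

Definition co_fin (R : realType) (X : lmodType R) (n : nat) (xs : 'I_n -> X)
  : set X :=
  [set x | exists l : 'I_n -> R, (forall i, 0 <= l i) /\ \sum_(i < n) l i = 1
            /\ x = \sum_(i < n) l i *: xs i].

Definition convex_subset (R : realType) (X : lmodType R) (D : set X) : Prop :=
  forall x y (t : R), D x -> D y -> 0 <= t -> t <= 1 -> D (t *: x + (1 - t) *: y).

Definition closed_in (X : topologicalType) (D A : set X) : Prop :=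
  exists C : set X, closed C /\ A = D `&` C.

Definition KKM_type (R : realType) (X : lmodType R) (Y : lmodType R)
  (D : set X) (G : X -> X -> set Y) : Prop :=
  forall (n : nat) (xs : 'I_n -> X), (forall i, D (xs i)) ->
    forall x, co_fin xs x -> D x -> exists j : 'I_n, G (xs j) x 0.

(* Main.v *)
(** By compactness of [D] it suffices to find, for finitely many [y_i], a point
of [D] lying in all the closed sets [{x | F x y_i 0}].  Pulled back along
[l |-> \sum_i l i *: z_i], where [z_i] is given for [y_i] by (iii), these sets
satisfy the hypothesis of the Knaster-Kuratowski-Mazurkiewicz (KKM) lemma on a
simplex.

The KKM lemma is proved without triangulations, by Scarf's ordinal version of
Sperner's lemma.  The points of the grid of mesh [1/N] are totally ordered by
each coordinate, and one slack vertex per coordinate [i] is added, the least one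
for the order [i] and above the grid for the others.  A set [T] of vertices is
dominant if no vertex exceeds [min T] in every order.  Counting mod 2 the pairs
of a dominant set with as many vertices as orders and a facet of it carrying all
colours but one shows that every colouring of the grid admits a rainbow dominant
set; such a set is small and close to the face of the coordinates whose slack it
avoids.  Were the grid point [v] always at distance more than [n/N] from some
[A_i], colouring [v] by such an [i] would contradict the covering hypothesis at
a point of that face. *)

Require Import Defs.
From HB Require Import structures.
From mathcomp Require Import all_boot all_order all_algebra.
Set Implicit Arguments. Unset Strict Implicit. Unset Printing Implicit Defensive.

(** * Scarf's lemma on dominant sets, by parity *)

(** One fibre of [f] on [S] is a pair and the others are singletons; only a point of the pair can be
    deleted without losing a value. Used for the map from orders to minima and for colours. *)
Lemma imset_collision (A B : finType) (f : A -> B) (S : {set A}) :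
  #|f @: S|.+1 = #|S| ->
  exists a1 a2, [/\ a1 \in S, a2 \in S, a1 != a2, f a1 = f a2 &
    {in S, forall a, (f @: (S :\ a) == f @: S) = (a \in [set a1; a2])}].
Proof.
move=> cS.
have /dinjectivePn[a1 a1S [a2]] : ~~ dinjectiveb f (mem S).
  apply/negP => /dinjectiveP /card_in_imset eS.
  by move: cS; rewrite eS => /esym/eqP; rewrite eqn_leq ltnn andbF.
rewrite !inE => /andP[a21 a2S] f12.
exists a1, a2; split=> //; first by rewrite eq_sym.
have sub a a' : a' \in S -> a' != a -> f a = f a' -> f @: (S :\ a) = f @: S.
  move=> a'S a'a faa'; apply/eqP; rewrite eqEsubset imsetS ?subsetDl //=.
  apply/subsetP => _ /imsetP[b bS ->].
  have [->|ba] := eqVneq b a; first by rewrite faa' imset_f // !inE a'a.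
  by rewrite imset_f // !inE ba.
move=> a aS; rewrite !inE; apply/eqP/orP => [fE|[/eqP->|/eqP->]].
- apply/orP; apply: contraT; rewrite negb_or => /andP[aa1 aa2].
  have : #|f @: (S :\ a)| <= #|S :\ a :\ a1|.
    rewrite -(_ : f @: (S :\ a :\ a1) = f @: (S :\ a)) ?leq_imset_card //.
    apply/eqP; rewrite eqEsubset imsetS ?subsetDl //=.
    apply/subsetP => _ /imsetP[b bS ->].
    have [->|ba] := eqVneq b a1.
      by rewrite f12 imset_f // !inE a21 eq_sym aa2.
    by rewrite imset_f // in_setD1 ba.
  have := cardsD1 a S; rewrite aS; have := cardsD1 a1 (S :\ a).
  rewrite !inE eq_sym aa1 a1S /= fE => e1 e2.
  by move: cS; rewrite e2 e1 !add1n => -[->]; rewrite ltnn.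
- exact: (sub _ a2).
- by apply: (sub _ a1); rewrite // eq_sym.
Qed.

Section DominantSets.
Variables (I W : finType) (u : I -> W -> nat) (bot : I -> W) (c : W -> I).
Hypothesis u_inj : forall i, injective (u i).
Hypothesis bot_min : forall i w, u i (bot i) <= u i w.
Hypothesis bot_top : forall i k w,
  i != k -> w \notin codom bot -> u i w < u i (bot k).
Hypothesis c_bot : cancel bot c.

(** For [w] in [T] the condition makes [w] the minimum of [T] in some order, so a dominant set has
    at most [#|I|] elements. *)
Definition dominant (T : {set W}) :=
  [forall w, exists i, forall t in T, u i w <= u i t].

Lemma dominantP (T : {set W}) :
  reflect (forall w, exists i, forall t, t \in T -> u i w <= u i t)
          (dominant T).
Proof.
apply: (iffP forallP) => h w.
  by have /existsP[i /forall_inP hi] := h w; exists i.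
by apply/existsP; have [i hi] := h w; exists i; apply/forall_inP.
Qed.

Lemma dominantS (S T : {set W}) : S \subset T -> dominant T -> dominant S.
Proof.
move=> /subsetP ST /dominantP dT; apply/dominantP => w.
by have [i hi] := dT w; exists i => t /ST/hi.
Qed.

Definition completions (T : {set W}) :=
  [set w | (w \notin T) && dominant (w |: T)].

Lemma card_argmax i (M : {set W}) : M != set0 ->
  #|[set w in M | [forall w' in M, u i w' <= u i w]]| = 1.
Proof.
case/set0Pn => w0 w0M; apply/eqP/cards1P.
have [w wM wmax] := @arg_maxnP W w0 [pred w | w \in M] (u i) w0M.
exists w; apply/setP => x; rewrite !inE.
apply/andP/eqP => [[xM /forall_inP xmax]|->].
  by apply: (@u_inj i); apply/eqP; rewrite eqn_leq xmax // andbT; apply: wmax.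
by split=> //; apply/forall_inP => y; exact: wmax.
Qed.

(* Exactly two orders [j1], [j2] have the same minimum in [T]; a vertex
completing [T] is, for [j] one of the two, the [j]-largest of the vertices above
[T] in every order but [j]. *)
Lemma completions_inner (T : {set W}) t0 : dominant T -> t0 \in T ->
    #|T|.+1 = #|I| ->
    ~~ (T \subset codom bot) ->
  #|completions T| = 2.
Proof.
move=> dT t0T cT nbT.
pose m k := [arg min_(t < t0 in T) u k t].
have mP k : m k \in T /\ forall t, t \in T -> u k (m k) <= u k t.
  by rewrite /m; case: arg_minnP.
have mE k t : t \in T -> (forall t', t' \in T -> u k t <= u k t') -> t = m k.
  move=> tT tmin; apply: (@u_inj k); apply/eqP.
  by rewrite eqn_leq tmin ?(mP k).1 // (mP k).2.
have imm : m @: [set: I] = T.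
  apply/setP => t; apply/imsetP/idP => [[k _ ->]|tT]; first by case: (mP k).
  by have [k hk] := dominantP _ dT t; exists k => //; exact: mE.
have [j1 [j2 [_ _ j12 m12 mD]]] : exists j1 j2, [/\ j1 \in [set: I],
    j2 \in [set: I], j1 != j2, m j1 = m j2 &
    {in [set: I], forall a,
      (m @: (setT :\ a) == m @: setT) = (a \in [set j1; j2])}].
  by apply: imset_collision; rewrite imm cT cardsT.
have {}mD j : (m @: (setT :\ j) == T) = (j \in [set j1; j2]).
  by rewrite -mD ?inE // imm.
pose M j := [set w | [forall (k | k != j), u k (m k) < u k w]].
have MP j w : reflect (forall k, k != j -> u k (m k) < u k w) (w \in M j).
  by rewrite inE; apply: (iffP forall_inP).
pose X j := [set w in M j | [forall w' in M j, u j w' <= u j w]].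
(* Such a [w] would lie above the minimum of [T] in every order, against dominance. *)
have M12 w : w \in M j1 -> w \in M j2 -> False.
  move=> /MP h1 /MP h2; have [k hk] := dominantP _ dT w.
  have := hk _ (mP k).1; rewrite leqNgt.
  by have [kj|/h1->//] := eqVneq k j1; rewrite h2 // kj.
have roomsE : completions T = X j1 :|: X j2.
  have XP j w : j \in [set j1; j2] -> w \in X j -> w \in completions T.
    rewrite -mD => /eqP mj; rewrite inE => /andP[wM /forall_inP wmax].
    rewrite inE; apply/andP; split.
      apply/negP; rewrite -mj => /imsetP[k]; rewrite !inE andbT => kj wk.
      by have /MP/(_ _ kj) := wM; rewrite wk ltnn.
    apply/dominantP => x.
    have [xM|xM] := boolP (x \in M j).
      exists j => t; rewrite !inE => /orP[/eqP->|tT]; first exact: wmax.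
      have [k hk] := dominantP _ dT w.
      have [kj|kj] := eqVneq k j.
        by rewrite -kj (leq_trans _ (hk _ tT)) // kj wmax.
      by have /MP/(_ _ kj) := wM; rewrite ltnNge hk // (mP k).1.
    have [k kj kx] : exists2 k, k != j & u k x <= u k (m k).
      move: xM; rewrite inE negb_forall => /existsP[k].
      rewrite negb_imply -leqNgt.
      by case/andP; exists k.
    exists k => t; rewrite !inE => /orP[/eqP->|tT].
      by rewrite (leq_trans kx) // ltnW //; apply/MP: kj.
    by rewrite (leq_trans kx) // (mP k).2.
  apply/setP => w; apply/idP/setUP => [|[]]; last 2 first.
  - by apply: XP; rewrite !inE eqxx.
  - by apply: XP; rewrite !inE eqxx orbT.
  rewrite inE => /andP[wT /dominantP dw].
  have [j hj] := dw w.
  (* Each [t] in [T] is minimal in [w |: T] for some order, which is not [j] because [w] is the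
     minimum there. So [m] stays onto [T] without [j]. *)
  have sub : T \subset m @: (setT :\ j).
    apply/subsetP => t tT; have [k hk] := dw t.
    have tk : t = m k.
      by apply: mE => // t' t'T; apply: hk; rewrite inE t'T orbT.
    rewrite tk imset_f // !inE andbT; apply: contraNneq wT => kj.
    suff -> : w = t by [].
    apply: (@u_inj k); apply/eqP; rewrite eqn_leq hk ?setU11 // andbT.
    by rewrite kj hj // inE tT orbT.
  have jE : j \in [set j1; j2].
    by rewrite -mD eqEsubset sub andbT -imm imsetS // subsetDl.
  (* Off [j] the map [m] is injective by cardinality, so the order in which [m k] is minimal in
     [w |: T] must be [k] itself. *)
  have ltm k : k != j -> u k (m k) < u k w.
    move=> kj.
    have [k' hk'] := dw (m k).
    have mkk' : m k = m k'.
      by apply: mE; [case: (mP k)|move=> t tT; apply: hk'; rewrite inE tT orbT].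
    have k'j : k' != j.
      apply: contraNneq wT => k'j.
      suff -> : w = m k by case: (mP k).
      apply: (@u_inj j); apply/eqP; rewrite eqn_leq hj /= -?k'j ?hk' ?setU11 //.
      by rewrite inE (mP k).1 orbT.
    have inj : {in setT :\ j &, injective m}.
      apply/imset_injP; rewrite (_ : m @: _ = T); last first.
        by apply/eqP; rewrite mD.
      by have := cardsD1 j [set: I]; rewrite !inE cardsT -cT add1n => -[->].
    have -> : k = k' by apply: inj; rewrite ?inE ?kj ?k'j.
    rewrite ltn_neqAle -mkk' hk' ?setU11 // andbT.
    by apply: contraNneq wT => /(@u_inj k') <-; case: (mP k).
  suff wX : w \in X j.
    by move: jE wX; rewrite !inE => /orP[/eqP->|/eqP->]; [left|right].
  rewrite inE; apply/andP; split; first exact/MP.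
  apply/forall_inP => x xM; have [k hk] := dw x.
  have [<-|kj] := eqVneq k j; first by rewrite hk ?setU11.
  by have /MP/(_ _ kj) := xM; rewrite ltnNge hk // inE (mP k).1 orbT.
have /subsetPn[v vT vb] := nbT.
(* The witness is [bot j]. The non-slack [v] in [T] ensures that [m k], if a slack, is [bot k],
   which lies strictly below [bot j]. *)
have M0 j : j \in [set j1; j2] -> M j != set0.
  rewrite -mD => /eqP mj; apply/set0Pn; exists (bot j); apply/MP => k kj.
  have [mb|mb] := boolP (m k \in codom bot); last exact: bot_top.
  have [l ml] := codomP mb.
  have [kl|kl] := eqVneq k l.
    rewrite ml -kl ltn_neqAle bot_min andbT; apply/negP => /eqP/u_inj.
    by move=> /(can_inj c_bot) kj'; rewrite kj' eqxx in kj.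
  by have := (mP k).2 _ vT; rewrite leqNgt ml bot_top.
rewrite roomsE cardsU (_ : X j1 :&: X j2 = set0) ?cards0 ?subn0.
  by rewrite !card_argmax // M0 // !inE eqxx ?orbT.
apply/setP => w; rewrite !in_setI in_set0; apply/negP => /andP[].
rewrite !in_set => /andP[w1 _] /andP[w2 _].
by apply: (M12 w); rewrite inE.
Qed.

(** In an order [i] other than [i0] the minimum is [bot i], below every non-slack vertex, so only
    [i0] can dominate these. The sole completion is the [i0]-largest non-slack vertex. *)
Lemma completions_outer i0 v0 : v0 \notin codom bot ->
  #|completions (bot @: (~: [set i0]))| = 1.
Proof.
move=> v0b; set T := bot @: _.
have botT k : (bot k \in T) = (k != i0).
  by rewrite mem_imset ?inE //; exact: can_inj c_bot.
have nbT w : w \notin codom bot -> w \notin T.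
  by apply: contraNN => /imsetP[k _ ->]; exact: codom_f.
have bot_lt k w : w \notin codom bot -> u k (bot k) < u k w.
  move=> wb; rewrite ltn_neqAle bot_min andbT.
  apply: contraNneq wb => /u_inj <-.
  exact: codom_f.
rewrite -(@card_argmax i0 [set w | w \notin codom bot]); last first.
  by apply/set0Pn; exists v0; rewrite inE.
congr #|pred_of_set _|; apply/setP => w; rewrite !inE.
apply/andP/andP => -[].
  move=> wT /dominantP dw.
  have wb : w \notin codom bot.
    apply/negP => /codomP[k wk]; move: wT; rewrite wk botT negbK => /eqP ki0.
    have [i hi] := dw v0.
    have := hi (bot i); rewrite leqNgt bot_lt // !inE wk ki0 botT.
    by have [->|_] := eqVneq i i0; rewrite ?eqxx ?orbT => /(_ isT).
  split=> //; apply/forall_inP => v; rewrite inE => vb.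
  have [i hi] := dw v; have [ii|ii] := eqVneq i i0.
    by rewrite -ii hi ?setU11.
  by have := hi (bot i); rewrite leqNgt bot_lt // !inE botT ii orbT => /(_ isT).
move=> wb /forall_inP wmax; split; first exact: nbT.
apply/dominantP => x; have [/codomP[k ->]|xb] := boolP (x \in codom bot).
  by exists k => t _; exact: bot_min.
exists i0 => t; rewrite !inE => /orP[/eqP->|/imsetP[k]].
  by apply: wmax; rewrite inE.
by rewrite !inE => ki ->; rewrite ltnW // bot_top // eq_sym.
Qed.

(** A set with all colours has one such facet, a set missing exactly [i0] has two, any other has
    none. *)
Lemma odd_card_rainbow_facets i0 (R : {set W}) : #|R| = #|I| ->
  odd #|[set w in R | c @: (R :\ w) == ~: [set i0]]| = (c @: R == setT).
Proof.
move=> cR.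
have [cRT|cRT] := eqVneq (c @: R) setT.
  have cinj : {in R &, injective c}.
    by apply/imset_injP; rewrite cRT cardsT cR.
  have /imsetP[w wR wi] : i0 \in c @: R by rewrite cRT inE.
  suff -> : [set w in R | c @: (R :\ w) == ~: [set i0]] = [set w].
    by rewrite cards1.
  apply/setP => x; rewrite !inE; apply/andP/eqP => [[xR /eqP cx]|->].
    apply: contraTeq isT => xw.
    have : c w \in c @: (R :\ x) by rewrite imset_f // !inE eq_sym xw.
    by rewrite cx !inE wi eqxx.
  split=> //; apply/eqP/setP => k; rewrite !inE.
  apply/imsetP/idP => [[y]|ki].
    rewrite !inE => /andP[yw yR] ->; apply: contraNneq yw.
    by rewrite wi => /cinj ->.
  have /imsetP[y yR yk] : k \in c @: R by rewrite cRT inE.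
  exists y => //; rewrite !inE yR andbT; apply: contraNneq ki => yw.
  by rewrite yk yw wi.
have [cRi|cRi] := eqVneq (c @: R) (~: [set i0]); last first.
  rewrite (_ : [set w in R | _] = set0) ?cards0 //.
  apply/setP => w; rewrite !inE; apply/negP => /andP[wR /eqP cw].
  have cRE : c @: R = c w |: ~: [set i0].
    by rewrite -cw -imsetU1 setD1K.
  have [cwi|cwi] := eqVneq (c w) i0.
    by move/eqP: cRT; apply; rewrite cRE cwi setUCr.
  by move/eqP: cRi; apply; rewrite cRE; apply/setUidPr; rewrite sub1set !inE.
have [w1 [w2 [w1R w2R w12 _ wE]]] : exists a1 a2,
    [/\ a1 \in R, a2 \in R, a1 != a2, c a1 = c a2 &
    {in R, forall a, (c @: (R :\ a) == c @: R) = (a \in [set a1; a2])}].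
  apply: imset_collision; rewrite cRi cR cardsC1 prednK //.
  by apply/card_gt0P; exists i0.
rewrite (_ : [set w in R | _] = [set w1; w2]) ?cards2 ?w12 //.
apply/setP => w; rewrite inE -cRi.
apply/andP/idP => [[wR]|]; first by rewrite wE.
move=> w12E; have wR : w \in R.
  by move: w12E; rewrite !inE => /orP[/eqP->|/eqP->].
by rewrite wE.
Qed.

Lemma rainbow_dominant (i0 : I) (v0 : W) : v0 \notin codom bot ->
  exists T : {set W}, [/\ dominant T, #|T| = #|I| & c @: T = setT].
Proof.
move=> v0b.
pose door (T : {set W}) := (#|T|.+1 == #|I|) && (c @: T == ~: [set i0]).
pose room (T : {set W}) := (#|T| == #|I|) && dominant T.
(* Both sides count pairs of a door and a vertex completing it to a room. *)
have count : \sum_(T | door T) #|completions T| =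
    \sum_(T | room T) #|[set w in T | c @: (T :\ w) == ~: [set i0]]|.
  under eq_bigr do rewrite -sum1_card big_mkcond.
  under [RHS]eq_bigr do rewrite -sum1_card big_mkcond.
  rewrite exchange_big [RHS]exchange_big /=; apply: eq_bigr => w _.
  rewrite -!big_mkcondr /=.
  rewrite (reindex_onto (fun T => T :\ w) (fun T => w |: T)) /=; last first.
    by move=> T; rewrite !inE => /andP[_ /andP[wT _]]; rewrite setU1K.
  apply: eq_bigl => T; rewrite /door /room !inE eqxx /=.
  have [wT|wT] := boolP (w \in T); last first.
    rewrite andbF; apply/negP => /andP[_ /eqP TE].
    by move: wT; rewrite -TE setU11.
  rewrite setD1K // eqxx andbT /= (cardsD1 w T) wT add1n.
  by case: (_ == #|I|); rewrite //= andbC.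
(* The door made of slacks has one completion. Any other door has two if dominant, since it contains
   a non-slack vertex, and none otherwise. *)
have lhs : odd (\sum_(T | door T) #|completions T|).
  pose T0 := bot @: (~: [set i0]).
  have dT0 : door T0.
    rewrite /door /T0 card_imset; last exact: can_inj c_bot.
    rewrite cardsC1 prednK; last by apply/card_gt0P; exists i0.
    rewrite eqxx -imset_comp; apply/eqP; rewrite -[RHS]imset_id.
    exact: eq_imset.
  rewrite (bigD1 T0) //= (completions_outer _ v0b) oddD /=.
  rewrite (big_morph odd oddD (erefl _)) big1 // => T.
  move=> /andP[/andP[/eqP cT /eqP cTi] TT0].
  have [dT|dT] := boolP (dominant T); last first.
    rewrite (_ : completions T = set0) ?cards0 //.
    apply/setP => w; rewrite !inE; apply/negP => /andP[_ dw].
    by move/negP: dT; apply; apply: dominantS dw; rewrite subsetUr.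
  have nb : ~~ (T \subset codom bot).
    apply: contraNN TT0 => /subsetP Tb; apply/eqP.
    rewrite /T0 -cTi -imset_comp -[LHS]imset_id; apply: eq_in_imset => t /Tb.
    by case/codomP => k -> /=; rewrite c_bot.
  have /subsetPn[t tT _] := nb.
  by rewrite (completions_inner dT tT).
move: lhs; rewrite count (big_morph odd oddD (erefl _)) => rhs.
have [/existsP[T /and3P[dT /eqP cT /eqP cTT]]|no] :=
    boolP [exists T : {set W}, [&& dominant T, #|T| == #|I| & c @: T == setT]].
  by exists T.
move: rhs; rewrite big1 // => T /andP[cT dT].
rewrite odd_card_rainbow_facets; last exact/eqP.
by apply: contraNF no => cTT; apply/existsP; exists T; rewrite dT cT.
Qed.
End DominantSets.

(** * Grid points of the simplex and their colourings *)

Definition grid (I : finType) (N : nat) :=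
  {v : {ffun I -> 'I_N.+1} | \sum_i v i == N}.

Lemma grid_top_up (I : finType) (N : nat) (j0 : I) (a : I -> nat) :
  \sum_i a i <= N ->
  exists x : grid I N,
    forall i, val x i = a i + (i == j0) * (N - \sum_i a i) :> nat.
Proof.
move=> aN; pose b i := a i + (i == j0) * (N - \sum_i a i).
have sb : \sum_i b i = N.
  rewrite big_split /= [X in _ + X](bigD1 j0) //= eqxx mul1n.
  by rewrite [X in _ + (_ + X)]big1 ?addn0 ?subnKC // => i /negPf->.
have bN i : b i < N.+1 by rewrite ltnS -sb (bigD1 i) //= leq_addr.
have xP : \sum_i [ffun i => Ordinal (bN i)] i == N.
  by rewrite -[X in _ == X]sb; apply/eqP/eq_bigr => i _; rewrite ffunE.
exists (exist (fun v : {ffun I -> 'I_N.+1} => \sum_i v i == N) _ xP) => i.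
by rewrite /= ffunE.
Qed.

(** In a rainbow dominant set, [x] is the vector of coordinatewise minima of the grid points, set to
    0 where the slack is present and topped up to sum [N]. A colour whose slack is absent is carried
    by a grid point near [x]. *)
Lemma grid_nearly_coloured (I : finType) (N : nat) (i0 : I)
    (c : grid I N -> I) :
  exists x : grid I N, forall j, 0 < val x j ->
    exists2 s : grid I N, c s = j &
      forall i, val s i < val x i + #|I| /\ val x i < val s i + #|I|.
Proof.
pose V := grid I N; pose M := #|{: V}|.
(* Ties between grid points with the same [j]-coordinate are broken by
[enum_rank]. *)
pose u (j : I) (w : V + I) : nat := match w with
  | inl v => (val v j * M + enum_rank v).+1
  | inr k => if j == k then 0 else (N.+1 * M + enum_rank k).+1
  end.
(* Grid ranks are lexicographic codes below [N.+1 * M], where the foreign slacks start; the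
   successor in [u] reserves 0 for the slack of [j]. *)
have ltu j (v : V) : val v j * M + enum_rank v < N.+1 * M.
  rewrite (@leq_trans (val v j * M + M)) // ?ltn_add2l ?ltn_ord //.
  by rewrite -mulSnr leq_mul2r ltn_ord orbT.
have u_inj j : injective (u j).
  move=> [v|k] [v'|k'] /=.
  - case=> e; congr inl; apply: enum_rank_inj; apply: val_inj.
    have := congr1 (modn^~ M) e.
    by rewrite !modnMDl !modn_small.
  - case: eqP => // _ [] e; have := ltu j v.
    by rewrite e ltnNge leq_addr.
  - case: eqP => // _ [] e; have := ltu j v'.
    by rewrite -e ltnNge leq_addr.
  - case: eqP => [<-|_]; case: eqP => [<-//|_] // [] /addnI e.
    by congr inr; apply: enum_rank_inj; apply: val_inj.
have notbot w : w \notin codom (inr : I -> V + I) -> exists v, w = inl v.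
  by case: w => [v _|k]; [exists v|rewrite codom_f].
have bot_min j w : u j (inr j) <= u j w by rewrite /= eqxx.
have bot_top i k w : i != k -> w \notin codom inr -> u i w < u i (inr k).
  move=> /negPf ik /notbot[v ->] /=; rewrite ik ltnS.
  by rewrite (leq_trans (ltu i v)) // leq_addr.
pose c' (w : V + I) := match w with inl v => c v | inr k => k end.
have [v0 _] : exists x : V, forall i,
    val x i = 0 + (i == i0) * (N - \sum_(i : I) 0) :> nat.
  by apply: grid_top_up; rewrite big1.
have v0b v : (inl v : V + I) \notin codom inr by apply/negP => /codomP[].
have c'_bot : cancel inr c' by [].
have [T [/dominantP dT cT colT]] :=
  rainbow_dominant u_inj bot_min bot_top c'_bot i0 (v0b v0).
pose J := [set j : I | inr j \notin T].
pose S := [set v : V | inl v \in T].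
have noslack v i : i \notin J -> ~ (forall t, t \in T -> u i (inl v) <= u i t).
  by rewrite inE negbK => iT /(_ _ iT); rewrite /= eqxx.
have card_slack : #|[set (inr i : V + I) | i in [set: I]]| = #|I|.
  by rewrite card_imset ?cardsT //; exact: inr_inj.
have [s0 s0S] : exists s0, s0 \in S.
  apply/set0Pn/negP => /eqP S0; have [i hi] := dT (inl v0).
  apply: noslack hi.
  rewrite inE negbK.
  suff -> : T = [set inr i | i in [set: I]] by rewrite imset_f.
  apply/eqP; rewrite eqEcard card_slack cT leqnn andbT.
  apply/subsetP => -[v vT|k _].
    by have := in_set0 v; rewrite -S0 inE vT.
  by rewrite imset_f.
have [j0 j0J] : exists j0, j0 \in J.
  apply/set0Pn; apply/negP => /eqP J0.
  have : [set inr i | i in [set: I]] == T.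
    rewrite eqEcard card_slack cT leqnn andbT.
    apply/subsetP => _ /imsetP[k _ ->].
    by have := in_set0 k; rewrite -J0 inE => /negbFE.
  move/eqP/setP/(_ (inl s0)); rewrite [_ \in T](_ : _ = true); last first.
    by move: s0S; rewrite inE.
  by move/imsetP => [].
(* The default 0 off [J], with [j0] in [J], keeps the support of [x] inside [J]. *)
pose m j :=
  if j \in J then nat_of_ord (val [arg min_(s < s0 in S) val s j] j) else 0.
have mS s i : s \in S -> m i <= val s i.
  by rewrite /m; case: ifP => // _ sS; case: arg_minnP => // s' _ /(_ _ sS).
have mT i : i \in J -> exists2 s, s \in S & m i = val s i.
  by move=> iJ; rewrite /m iJ; case: arg_minnP => // s sS _; exists s.
have sumV (s : V) : \sum_i val s i = N by apply/eqP/(valP s).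
have mN : \sum_i m i <= N.
  by rewrite -(sumV s0) leq_sum // => i _; exact: mS.
(* Otherwise some grid point exceeds [m] by at least 1 on all of [J]. It beats the minimum of [T] in
   those orders whatever the ties, and in the others the minimum is a slack, so [T] is not
   dominant. *)
have Nm : N < \sum_i m i + #|I|.
  rewrite ltnNge; apply/negP => mIN.
  have /(grid_top_up j0)[v vE] : \sum_i (m i + (i \in J)) <= N.
    rewrite big_split /= (leq_trans _ mIN) // leq_add2l -sum1_card.
    by apply: leq_sum => i _; case: (_ \in J).
  have [i hi] := dT (inl v).
  have [iJ|iJ] := boolP (i \in J); last exact: noslack hi.
  have [s sS mE] := mT _ iJ.
  have : u i (inl v) <= u i (inl s) by apply: hi; move: sS; rewrite inE.
  rewrite leqNgt /= ltnS => /negP; apply.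
  rewrite -mE (@leq_trans (m i * M + M)) // ?ltn_add2l ?ltn_ord //.
  rewrite -mulSnr (leq_trans _ (leq_addr _ _)) // leq_mul2r vE iJ addn1.
  by rewrite leq_addr orbT.
have [x xE] := grid_top_up j0 mN.
exists x => j xj.
have jJ : j \in J.
  apply: contraTT xj => jJ; rewrite xE {1}/m (negPf jJ) add0n -leqNgt.
  by rewrite [j == j0](_ : _ = false) //; apply: contraNF jJ => /eqP->.
have /imsetP[[s|k] sT jE] : j \in c' @: T by rewrite colT inE.
  exists s => // i.
  have sS : s \in S by rewrite inE.
  (* No single coordinate of [s] exceeds [m] by more than the total excess. *)
  have si : val s i <= m i + (N - \sum_i m i).
    have <- : \sum_i (val s i - m i) = N - \sum_i m i.
      by rewrite sumnB ?sumV // => k _; exact: mS.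
    by rewrite (bigD1 i) //= addnA subnKC ?mS // leq_addr.
  have dI : N - \sum_i m i < #|I| by rewrite ltn_subLR.
  split; rewrite xE.
    rewrite (leq_ltn_trans si) // addnAC (leq_trans _ (leq_addr _ _)) //.
    by rewrite ltn_add2l.
  rewrite (@leq_trans (m i + #|I|)) // ?leq_add2r ?mS // ltn_add2l.
  by rewrite (leq_ltn_trans _ dI) //; case: (_ == _); rewrite ?mul1n.
by move: jJ; rewrite inE jE sT.
Qed.

From mathcomp Require Import finmap.
From mathcomp Require Import all_classical all_reals all_analysis.
Import Order.TTheory GRing.Theory Num.Theory.
Import numFieldNormedType.Exports.
Local Open Scope classical_set_scope.
Local Open Scope ring_scope.

(** * The KKM lemma on the simplex *)

Definition simplex (R : realType) (n : nat) : set 'rV[R]_n.+1 :=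
  [set l | (forall i, 0 <= l 0 i) /\ \sum_i l 0 i = 1].
Arguments simplex : clear implicits.

Lemma sum_scale_continuous (R : realType) (X : topologicalLmodType R) (n : nat)
    (xs : 'I_n -> X) :
  continuous (fun l : 'rV[R]_n => \sum_i l 0 i *: xs i).
Proof.
apply: continuous_big => [|i _ l]; first exact: add_continuous.
apply: (@continuous_comp _ _ _ (fun l : 'rV[R]_n => (l 0 i : R^o, xs i))
  (fun x : R^o * X => x.1 *: x.2)); last exact: scale_continuous.
have h1 : (fun m : 'rV[R]_n => m 0 i : R^o) @ l --> nbhs (l 0 i : R^o).
  exact: (@coord_continuous R 1 n 0 i l).
have h2 : (fun m : 'rV[R]_n => xs i) @ l --> nbhs (xs i).
  exact: cst_continuous.
exact: (cvg_pair h1 h2).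
Qed.

Lemma simplex_compact (R : realType) (n : nat) : compact (@simplex R n).
Proof.
have cube_compact := @rV_compact R n.+1
  (fun=> [set` `[0, 1]%R]) (fun=> @segment_compact R 0 1).
apply: (subclosed_compact _ cube_compact); last first.
  move=> l [l0 l1] i /=; rewrite in_itv /= l0 -l1 (bigD1 i) //= lerDl.
  by apply: sumr_ge0.
(* Weighting copies of [1 : R^o] puts the sum in the form covered by [sum_scale_continuous]. *)
rewrite (_ : simplex _ _ = (\bigcap_i [set l : 'rV[R]_n.+1 | 0 <= l 0 i])
   `&` [set l | \sum_i l 0 i *: (1 : R^o) = 1]); last first.
  apply/seteqP; split=> [l [l0 l1]|l [l0 l1]]; split=> //=.
  - by move=> i _; exact: l0.
  - by rewrite -[RHS]l1; apply: eq_bigr => i _; exact: mulr1.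
  - by move=> i; exact: l0.
  - by rewrite -[RHS]l1; apply: eq_bigr => i _; rewrite [RHS]mulr1.
apply: closedI.
  apply: closed_bigI => i _.
  apply: (preimage_closed (f := fun l : 'rV[R]_n.+1 => l 0 i)
    (D := [set x | 0 <= x])).
    by move=> x _; exact: coord_continuous.
  exact: closed_ge.
apply: (preimage_closed
  (f := fun l : 'rV[R]_n.+1 => \sum_i l 0 i *: (1 : R^o))
  (D := [set x | x = 1])).
  by move=> x _; exact: sum_scale_continuous.
exact: closed_eq.
Qed.

(** The condition [0 < l 0 i] says that [i] is a vertex of the smallest face containing [l]. Grid
    points ever closer to all the [A i] have a cluster point by compactness, and it lies in every
    [A i]. *)
Lemma KKM_simplex (R : realType) (n : nat) (A : 'I_n.+1 -> set 'rV[R]_n.+1) :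
  (forall i, closed (A i)) ->
  (forall l, simplex R n l -> exists2 i, 0 < l 0 i & A i l) ->
  exists2 l, simplex R n l & forall i, A i l.
Proof.
move=> Acl Acov.
pose pt k (v : grid 'I_n.+1 k.+1) : 'rV[R]_n.+1 :=
  \row_i ((val v i)%:R / k.+1%:R).
have pt_simplex k v : simplex R n (pt k v).
  split=> [i|]; first by rewrite mxE divr_ge0.
  under eq_bigr do rewrite mxE.
  by rewrite -mulr_suml -natr_sum (eqP (valP v)) divff // pnatr_eq0.
have near k : exists w, simplex R n w /\ forall i, exists2 p, A i p &
    forall j, `|w 0 j - p 0 j| <= n.+1%:R / k.+1%:R.
  apply: contrapT => no.
  have /choice[c cP] : forall v : grid 'I_n.+1 k.+1, exists i,
      ~ exists2 p, A i p & forall j, `|pt k v 0 j - p 0 j| <= n.+1%:R / k.+1%:R.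
    by move=> v; apply/existsNP => h; apply: no; exists (pt k v).
  (* Covering at [x] yields [j] in its support with [x] in [A j]; the point [s] of colour [j] is
     then close to [A j], against the choice of [c]. *)
  have [x xP] := grid_nearly_coloured ord0 c.
  have [j xj Aj] := Acov _ (pt_simplex k x).
  have [|s cs sx] := xP j.
    by move: xj; rewrite mxE pmulr_lgt0 ?invr_gt0 ?ltr0n.
  apply: (cP s); rewrite cs; exists (pt k x) => // i.
  rewrite !mxE -mulrBl normrM (ger0_norm (x := _^-1)) ?invr_ge0 //.
  rewrite ler_pM2r ?invr_gt0 ?ltr0n // ler_distl.
  have [s1 s2] := sx i; rewrite card_ord in s1 s2.
  by rewrite lerBlDr -!natrD !ler_nat (ltnW s1) (ltnW s2).
have [w wP] := choice near.
have wS : (w @ \oo) (simplex R n) by exists 0%N => // k _; case: (wP k).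
have [l [lS lcl]] := @simplex_compact R n (w @ \oo) _ wS.
exists l => // i; apply: Acl => B /nbhs_ballP[e /= e0 eB].
have e20 : 0 < e / 2 by rewrite divr_gt0.
have [K _ KP] : \forall k \near \oo, n.+1%:R / k.+1%:R < e / 2 :> R.
  have e2n : 0 < e / 2 / n.+1%:R by rewrite divr_gt0.
  apply: filterS (near_infty_natSinv_lt (PosNum e2n)) => k /=.
  by rewrite ltr_pdivlMr ?ltr0n // mulrC.
have wK : (w @ \oo) [set x | exists2 k, (K <= k)%N & x = w k].
  by exists K => // k Kk; exists k.
have [_ [[k Kk ->] [_ lw]]] := lcl _ _ wK (nbhsx_ballx l (e / 2) e20).
have [p Ap pw] := (wP k).2 i.
exists p; split=> //; apply: eB; split=> // a j; rewrite ord1.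
have := lw 0 j; rewrite /ball /= => h.
rewrite (le_lt_trans (ler_distD (w k 0 j) _ _)) //.
by rewrite [e](splitr) ltrD // (le_lt_trans (pw j)) // KP.
Qed.

(** * Convex combinations and the common point *)

Lemma convex_subset_sum (R : realType) (X : lmodType R) (D : set X) (n : nat)
    (xs : 'I_n -> X) (l : 'I_n -> R) :
  convex_subset D -> (forall i, D (xs i)) -> (forall i, 0 <= l i) ->
  \sum_i l i = 1 -> D (\sum_i l i *: xs i).
Proof.
move=> Dcvx; elim: n xs l => [|n IHn] xs l Dxs l0.
  by rewrite big_ord0 => /eqP; rewrite eq_sym oner_eq0.
rewrite !big_ord_recl => l1.
have rest_ge0 : 0 <= \sum_(i < n) l (lift ord0 i) by exact: sumr_ge0.
have restE : \sum_(i < n) l (lift ord0 i) = 1 - l ord0.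
  by rewrite -l1 addrAC subrr add0r.
have [r0|r0] := eqVneq (1 - l ord0) 0.
  rewrite big1 ?addr0 => [|i _].
    by move/eqP: r0; rewrite subr_eq0 => /eqP <-; rewrite scale1r.
  by move: restE; rewrite r0 => /psumr_eq0P -> //; rewrite scale0r.
have -> : \sum_(i < n) l (lift ord0 i) *: xs (lift ord0 i) =
    (1 - l ord0) *:
      \sum_(i < n) (l (lift ord0 i) / (1 - l ord0)) *: xs (lift ord0 i).
  rewrite scaler_sumr; apply: eq_bigr => i _.
  by rewrite scalerA mulrC divfK.
apply: Dcvx => //.
- apply: IHn => // [i|]; first by rewrite divr_ge0 // -restE.
  by rewrite -mulr_suml restE divff.
- by rewrite -subr_ge0 -restE.
Qed.

(** Dropping the zero weights forces the index supplied by [KKM_type] to have positive weight, as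
    [KKM_simplex] demands. *)
Lemma co_fin_support (R : realType) (X : lmodType R) (n : nat)
    (xs : 'I_n -> X) (l : 'I_n -> R) (J := [set i | 0 < l i]%SET) :
  (forall i, 0 <= l i) -> \sum_i l i = 1 ->
  co_fin (fun k : 'I_#|J| => xs (enum_val k)) (\sum_i l i *: xs i).
Proof.
move=> l0 l1; exists (fun k => l (enum_val k)); split=> //.
have off i : i \notin J -> l i = 0.
  by rewrite inE -leNgt => li; apply/eqP; rewrite eq_le li l0.
split.
  rewrite -(big_enum_val (fun i => l i)) /= big_mkcond -[RHS]l1.
  by apply: eq_bigr => i _; case: ifPn => // /off.
rewrite -(big_enum_val (fun i => l i *: xs i)) /= [RHS]big_mkcond.
by apply: eq_bigr => i _; case: ifPn => // /off ->; rewrite scale0r.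
Qed.

Theorem theorem2p2 (R : realType) (X Y : topologicalLmodType R)
  (D : set X) (K : Type) (F : X -> K -> set Y) (G : X -> X -> set Y) :
  D !=set0 -> convex_subset D -> compact D -> inhabited K ->
  (forall y : K, closed_in D [set x | D x /\ F x y 0]) ->
  KKM_type D G ->
  (forall y : K, exists2 z, D z & forall x, D x -> G z x 0 -> F x y 0) ->
  exists2 xbar, D xbar & forall y : K, F xbar y 0.
Proof.
move=> _ Dcvx Dcpt [y0] Fcl Gkkm GF.
have [g gP] := choice Fcl.
have /choice[z zP] : forall y, exists z,
    D z /\ forall x, D x -> G z x 0 -> F x y 0.
  by move=> y; have [z] := GF y; exists z.
pose f (y : {classic K}) := [set x | D x /\ F x y 0].
have fg y : f y = D `&` g y by case: (gP y).
have fin : finI [set: {classic K}] f.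
  (* Prepending [y0] keeps the list nonempty even when [E] is empty. *)
  move=> E _; pose ys (i : 'I_(size E).+1) : K := nth y0 (y0 :: E) i.
  pose xs i := z (ys i).
  pose phi (l : 'rV[R]_(size E).+1) := \sum_i l 0 i *: xs i.
  have Dphi l : simplex R _ l -> D (phi l).
    by case=> l0 l1; apply: convex_subset_sum => // i; case: (zP (ys i)).
  (* The closed sets [g y] of [X] are pulled back rather than [f y], which is closed only relative
     to [D]. *)
  have [i|l lS|l lS lg] :=
    @KKM_simplex R (size E) (fun i => phi @^-1` g (ys i)).
  - apply: preimage_closed; last by case: (gP (ys i)).
    by move=> l _; exact: sum_scale_continuous.
  - have [l0 l1] := lS.
    have [|k Gk] := Gkkm _ _ _ _ (co_fin_support xs l0 l1) (Dphi l lS).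
      by move=> i; case: (zP (ys (enum_val i))).
    exists (enum_val k); first by have := enum_valP k; rewrite inE.
    suff : f (ys (enum_val k)) (phi l) by rewrite fg => -[].
    by split; [exact: Dphi|apply: (zP _).2 => //; exact: Dphi].
  - exists (phi l) => y /= yE.
    rewrite fg; split; first exact: Dphi.
    have iE : ((index y E).+1 < (size E).+1)%N by rewrite ltnS index_mem.
    have <- : ys (Ordinal iE) = y by exact: (@nth_index {classic K}).
    exact: lg.
have [|p [Dp pcl]] := Dcpt _ (finI_filter fin).
  by exists (f y0); [exact: finI_from1|move=> x []].
exists p => // y; suff : f y p by case.
rewrite fg; split=> //; apply: (gP y).1 => B Bp.
apply: pcl Bp; exists (f y); first exact: finI_from1.
by rewrite fg => x [].
Qed.
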